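(* Assume Borel's Conjecture. Then every Rothberger $T_3$ space is Hurewicz.
   Context: All topological spaces are assumed to be $T_3$ (regular and Hausdorff). A set of reals $X\subseteq\mathbb{R}$ has strong measure zero if and only if for every sequence $\{\varepsilon_n\}_{n<\omega}$ with each $\varepsilon_n>0$, $X$ can be covered by sets $\{X_n:n<\omega\}$ with each $X_n$ of diameter less than $\varepsilon_n$. Borel's Conjecture is the assertion that every strong measure zero set of reals is countable. A space $X$ is Rothberger if for every sequence $\{\mathcal{U}_n\}_{n<\omega}$ of open covers of $X$ one can pick $U_n\in\mathcal{U}_n$ for each $n<\omega$ such that $\{U_n:n<\omega\}$ covers $X$. A $\gamma$-cover of a space is a countably infinite open cover such that each point is in all but finitely many members of the cover. A space is Hurewicz if given a sequence $\{\mathcal{U}_n:n\in\omega\}$ of $\gamma$-covers, there is for each $n$ a finite $\mathcal{V}_n\subseteq\mathcal{U}_n$ such that either $\{\bigcup\mathcal{V}_n:n\in\omega\}$ is a $\gamma$-cover, or else for some $n$, $\bigcup\mathcal{V}_n$ is a cover. *)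

(* Defs.v *)
From mathcomp Require Import all_boot all_order all_algebra.
From mathcomp Require Import all_classical all_reals all_analysis.

Set Implicit Arguments.
Unset Strict Implicit.
Unset Printing Implicit Defensive.

Import Order.TTheory GRing.Theory Num.Theory.
Import numFieldNormedType.Exports.

Local Open Scope classical_set_scope.
Local Open Scope ring_scope.

(* The maximum with 0 gives the empty set diameter 0, since the supremum of the
   empty set in \bar R is -oo. *)
Definition diameter (R : realType) (A : set R) : \bar R :=
  maxe 0%E (ereal_sup [set `|x - y|%:E | x in A & y in A]).

Definition strong_measure_zero (R : realType) (X : set R) : Prop :=
  forall eps : nat -> R, (forall n, 0 < eps n) ->
  exists Y : nat -> set R,
    (forall n, (diameter (Y n) < (eps n)%:E)%E) /\ X `<=` \bigcup_n Y n.

Definition borel_conjecture (R : realType) : Prop :=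
  forall X : set R, strong_measure_zero X -> countable X.

Definition T3_space (T : topologicalType) : Prop :=
  regular_space T /\ hausdorff_space T.

Definition covers (T : Type) (C : set (set T)) : Prop :=
  \bigcup_(U in C) U = [set: T].

Definition open_cover (T : topologicalType) (C : set (set T)) : Prop :=
  C `<=` open /\ covers C.

Definition rothberger (T : topologicalType) : Prop :=
  forall C : nat -> set (set T), (forall n, open_cover (C n)) ->
  exists U : nat -> set T, (forall n, C n (U n)) /\ covers (range U).

Definition gamma_cover (T : topologicalType) (C : set (set T)) : Prop :=
  [/\ open_cover C, countable C, infinite_set C &
      forall x : T, finite_set [set U | C U /\ ~ U x]].

(* The first alternative concerns the set of the unions of the [V n], not the
   indexed sequence, so in particular these unions must be infinitely many. *)
Definition hurewicz (T : topologicalType) : Prop :=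
  forall C : nat -> set (set T), (forall n, gamma_cover (C n)) ->
  exists V : nat -> set (set T),
    (forall n, finite_set (V n) /\ V n `<=` C n) /\
    (gamma_cover (range (fun n => \bigcup_(U in V n) U)) \/
     exists n, covers (V n)).

(* Main.v *)
Require Import Defs.
From mathcomp Require Import all_boot all_order all_algebra.
From mathcomp Require Import all_classical all_reals all_analysis.
From mathcomp Require Import lra.

(** A Rothberger space T is Lindelof, and a continuous image of it in the reals
has strong measure zero, hence is countable by Borel's Conjecture.  The proof
draws two consequences from this countability.

The first is that T has a base of clopen sets.  Being regular and Lindelof, T is
normal ([rothberger_regular_normal]), so Urysohn's lemma separates a point from
a closed set by a continuous real function; its range is countable, so it omits
some r strictly between 0 and 1, and cutting at r gives a clopen set
([rothberger_zero_dim]).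

The second is that countably many clopen sets split the points of T into only
countably many classes, two points being equivalent when they lie in the same
sets.  Indeed the sequence of membership bits of a point, read as the digits of
a real number in base 4, is a continuous function on T that determines the class
([clopen_classes_countable]).

Now let (C n) be a sequence of open covers.  Refine each C n by a countable
clopen cover (D n i), with D n i included in a member U n i of C n
([refine_clopen]).  For the points of the m-th class one index p m n chosen for
each n suffices: D n (p m n) contains all of them.  Countably many functions p m
are eventually dominated by a single function g ([diagonal_bound]), so the
finite families V n = {U n i | i <= g n} have unions that contain any given
point from some n on.  Either these unions form a gamma-cover or one of them is
already the whole space ([eventual_cover]). *)

Set Implicit Arguments.
Unset Strict Implicit.
Unset Printing Implicit Defensive.

Import Order.TTheory GRing.Theory Num.Theory.
Import numFieldNormedType.Exports.

Local Open Scope classical_set_scope.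
Local Open Scope ring_scope.

(** * Lindelof property and normality *)

(** The constant sequence of covers already yields a countable subcover. *)
Lemma rothberger_lindelof (T : topologicalType) (C : set (set T)) :
  rothberger T -> open_cover C ->
  exists U : nat -> set T, (forall n, C (U n)) /\ (forall x, exists n, U n x).
Proof.
move=> HR oC; have [U [CU covU]] := HR (fun=> C) (fun=> oC).
exists U; split => // x.
have : [set: T] x by [].
by rewrite -covU => -[_ [n _ <-] Unx]; exists n.
Qed.

(** The separating neighbourhood of A in the classical proof that regular
Lindelof spaces are normal: from each W n whose closure misses B, the closures
of the earlier sets that miss A are removed.  Exchanging A and B gives the
neighbourhood of B. *)
Definition peel (T : topologicalType) (W : nat -> set T) (A B : set T) : set T :=
  \bigcup_(n in [set n | closure (W n) `&` B = set0])
    (W n `\` \bigcup_(i in [set i | (i <= n)%N /\ closure (W i) `&` A = set0])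
               closure (W i)).

Lemma open_peel (T : topologicalType) (W : nat -> set T) (A B : set T) :
  (forall n, open (W n)) -> open (peel W A B).
Proof.
move=> oO; apply: bigcup_open => n _; apply: openI => //.
apply: closed_openC; apply: closed_bigcup => [|i _]; last exact: closed_closure.
by apply: (@sub_finite_set _ _ `I_n.+1); [move=> i []|exact: finite_II].
Qed.

Lemma sub_peel (T : topologicalType) (W : nat -> set T) (A B : set T) :
  (forall x, exists n, W n x) ->
  (forall n, closure (W n) `&` A = set0 \/ closure (W n) `&` B = set0) ->
  A `<=` peel W A B.
Proof.
move=> covO sepO x Ax; have [n Onx] := covO x.
have missA i : closure (W i) `&` A = set0 -> ~ closure (W i) x.
  by move=> i0 clx; rewrite -falseE -(in_set0 x) inE -i0.
exists n.
  by case: (sepO n) => // /missA []; exact: subset_closure.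
by split=> // -[i [_ /missA]].
Qed.

(** A point of both sets lies in some W n and some W m; the closure of the one
with the smaller index has been removed from the other. *)
Lemma peel_disjoint (T : topologicalType) (W : nat -> set T) (A B : set T) :
  peel W A B `&` peel W B A = set0.
Proof.
rewrite -subset0 => x [[n nB [Onx nx]] [m mA [Omx mx]]].
have [nm|/ltnW mn] := leqP n m.
- by apply: mx; exists n => //; exact: subset_closure.
- by apply: nx; exists m => //; exact: subset_closure.
Qed.

(** Given disjoint closed A and B, regularity makes the open sets whose closure
misses A or misses B a cover of the space, and a countable subcover of it can be
peeled on both sides. *)
Lemma rothberger_regular_normal (R : realType) (T : topologicalType) :
  rothberger T -> @regular_space T -> @normal_space T.
Proof.
move=> HR rT; apply/(@normal_openP R) => A B clA clB AB0.
have avoid (D : set T) x : closed D -> ~ D x ->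
    exists W, [/\ open W, W x & closure W `&` D = set0].
  move=> clD nDx; have [|V Vx VD] := rT x (~` D).
    by apply: open_nbhs_nbhs; split => //; exact: closed_openC.
  exists V°; split; [exact: open_interior|exact: Vx|].
  apply/disjoints_subset; apply: subset_trans VD.
  by apply: closureS; exact: interior_subset.
have [|W [sepO covO]] := @rothberger_lindelof T [set W | open W /\
    (closure W `&` A = set0 \/ closure W `&` B = set0)] HR.
  split; first by move=> W [].
  apply/seteqP; split=> // x _.
  have [Ax|nAx] := pselect (A x).
    have [|V [oV Vx VB]] := @avoid B x clB.
      by move=> Bx; rewrite -falseE -(in_set0 x) inE -AB0.
    by exists V => //; split; [|right].
  by have [V [oV Vx VA]] := @avoid A x clA nAx; exists V => //; split; [|left].
exists (peel W A B), (peel W B A); split.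
- by apply: open_peel => n; have [] := sepO n.
- by apply: open_peel => n; have [] := sepO n.
- by apply: sub_peel => // n; have [] := sepO n.
- by apply: sub_peel => // n; have [_ /or_comm] := sepO n.
- exact: peel_disjoint.
Qed.

(** * Continuous real images and clopen bases *)

Lemma diameter_le (R : realType) (A : set R) (d : R) : 0 <= d ->
  (forall x y, A x -> A y -> `|x - y| <= d) -> (diameter A <= d%:E)%E.
Proof.
move=> d0 Ad; rewrite /diameter ge_max lee_fin d0 /=.
by apply: ge_ereal_sup => _ [x Ax [y Ay <-]]; rewrite lee_fin Ad.
Qed.

(** The preimages of the balls of radius eps n / 4 form the n-th cover; the image
of any of its members has diameter at most eps n / 2. *)
Lemma rothberger_image_smz (R : realType) (T : topologicalType) (f : T -> R) :
  rothberger T -> continuous f -> strong_measure_zero (range f).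
Proof.
move=> HR /continuousP cf eps eps0.
pose C n := range (fun x => f @^-1` ball (f x) (eps n / 4)).
have oC n : open_cover (C n).
  split; first by move=> _ [x _ <-]; apply: cf; exact: ball_open.
  apply/seteqP; split => // x _; exists (f @^-1` ball (f x) (eps n / 4)).
    by exists x.
  by apply: ballxx; rewrite divr_gt0.
have [U [CU covU]] := HR C oC.
exists (fun n => f @` U n); split.
  move=> n; apply: (@le_lt_trans _ _ (eps n / 2)%:E); last first.
    by rewrite lte_fin; have := eps0 n; lra.
  apply: diameter_le; first by have := eps0 n; lra.
  have [x _ <-] := CU n.
  move=> _ _ [y fy <-] [z fz <-].
  move: fy fz; rewrite /ball /= => fy fz.
  have -> : f y - f z = (f x - f z) - (f x - f y) by lra.
  apply: le_trans (ler_normB _ _) _; have := eps0 n; lra.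
move=> _ [x _ <-].
have : [set: T] x by [].
by rewrite -covU => -[_ [n _ <-] Unx]; exists n => //; exists x.
Qed.

Definition zero_dim_basis (T : topologicalType) : Prop :=
  forall (x : T) (U : set T), open U -> U x ->
  exists D, [/\ clopen D, D x & D `<=` U].

(** A countable set has Lebesgue measure 0, so it cannot contain the unit
interval. *)
Lemma countable_unit_gap (R : realType) (A : set R) : countable A ->
  exists2 r, 0 < r < 1 & ~ A r.
Proof.
move=> cA; apply: contrapT => nA.
have sA : `]0, 1[%classic `<=` A.
  move=> r; rewrite /= in_itv /= => r01.
  by apply: contrapT => nAr; apply: nA; exists r.
have /countable_lebesgue_measure0 : countable (`]0, 1[%classic : set R).
  by apply: sub_countable cA; exact: subset_card_le.
rewrite lebesgue_measure_itv /= lte_fin ltr01 => /eqP.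
by rewrite oppr0 adde0 eqe oner_eq0.
Qed.

(** If f is 0 at x, 1 outside U and never takes the value r, then f < r and
f <= r define the same set, which is therefore both open and closed. *)
Lemma rothberger_zero_dim (R : realType) (T : topologicalType) :
  borel_conjecture R -> T3_space T -> rothberger T -> zero_dim_basis T.
Proof.
move=> BC [rT hT] HR x U oU Ux.
have nT := @rothberger_regular_normal R T HR rT.
have /(@uniform_separatorP _ R)[f [cf _ fx fU]] :
    uniform_separator [set x] (~` U).
  apply: (@normal_completely_regular R) => //.
  - exact: hausdorff_accessible.
  - exact: open_closedC.
have [r /andP[r0 r1] nfr] :=
  countable_unit_gap (BC _ (rothberger_image_smz HR cf)).
exists (f @^-1` [set y | y < r]); split.
- split.
    by move/continuousP: (cf); apply; exact: open_lt.
  have -> : f @^-1` [set y | y < r] = f @^-1` [set y | y <= r].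
    apply/seteqP; split=> y /=; first exact: ltW.
    rewrite le_eqVlt => /orP[/eqP fyr|//].
    by case: nfr; exists y.
  by apply: preimage_closed => //; exact: closed_le.
- by rewrite /= (_ : f x = 0) //; apply: fx; exists x.
- move=> y /= fyr; apply: contrapT => nUy.
  have : f y = 1 by apply: fU; exists y.
  by move=> fy; move: (lt_trans fyr r1); rewrite fy ltxx.
Qed.

(** * Real numbers with prescribed binary digits in base 4 *)

Section bits.
Context {R : realType}.
Implicit Types b : nat -> bool.

Definition bit_sum b n : R := \sum_(i < n) (b i)%:R * 4%:R ^- i.

(** The sum of the series of the b i / 4 ^ i.  Base 2 would identify distinct
sequences of bits; in base 4 the digits after a position cannot make up for a
difference there. *)
Definition real_of_bits b : R := sup (range (bit_sum b)).

(** The upper bounds that the partial sums give for the series decrease: the next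
digit adds at most 4 ^- n, while the error term drops from 2 * 4 ^- n to half of
4 ^- n. *)
Lemma bit_sum_tail b n k :
  bit_sum b (n + k) + 2 * 4%:R ^- (n + k) <= bit_sum b n + 2 * 4%:R ^- n.
Proof.
elim: k => [|k IHk]; first by rewrite addn0.
apply: le_trans IHk; rewrite addnS /bit_sum big_ord_recr /= exprS invfM.
have : 0 < (4%:R : R) ^- (n + k) by rewrite invr_gt0 exprn_gt0.
by case: (b _) => /=; lra.
Qed.

Lemma bit_sum_mono b n k : bit_sum b n <= bit_sum b (n + k).
Proof.
elim: k => [|k IHk]; first by rewrite addn0.
apply: le_trans IHk _; rewrite addnS /bit_sum big_ord_recr /= lerDl.
by rewrite mulr_ge0 // invr_ge0 exprn_ge0.
Qed.

Lemma bit_sum_le b n m : bit_sum b m <= bit_sum b n + 2 * 4%:R ^- n.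
Proof.
have e0 k : 0 <= (4%:R : R) ^- k by rewrite invr_ge0 exprn_ge0.
have [/subnKC <-|/ltnW/subnKC <-] := leqP n m.
  have := bit_sum_tail b n (m - n); have := e0 (n + (m - n))%N; lra.
have := bit_sum_mono b m (n - m); have := e0 (m + (n - m))%N; lra.
Qed.

Lemma real_of_bits_bounds b n :
  bit_sum b n <= real_of_bits b <= bit_sum b n + 2 * 4%:R ^- n.
Proof.
apply/andP; split.
  apply: ub_le_sup; last by exists n.
  by exists (bit_sum b 0 + 2 * 4%:R ^- 0) => _ [m _ <-]; exact: bit_sum_le.
apply: ge_sup; first by exists (bit_sum b 0); exists 0%N.
by move=> _ [m _ <-]; exact: bit_sum_le.
Qed.

Lemma eq_bit_sum b b' n : (forall i, (i < n)%N -> b i = b' i) ->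
  bit_sum b n = bit_sum b' n.
Proof. by move=> bb'; apply: eq_bigr => i _; rewrite bb'. Qed.

Lemma real_of_bits_close b b' n : (forall i, (i < n)%N -> b i = b' i) ->
  `|real_of_bits b - real_of_bits b'| <= 2 * 4%:R ^- n.
Proof.
move=> /eq_bit_sum bb'.
have /andP[b1 b2] := real_of_bits_bounds b n.
have /andP[b1' b2'] := real_of_bits_bounds b' n.
by rewrite bb' in b1 b2; rewrite ler_norml; apply/andP; split; lra.
Qed.

(** The partial sums up to n.+1 differ by 4 ^- n, and the remaining digits of b
contribute at most 2 * 4 ^- n.+1, which is half of that. *)
Lemma real_of_bits_lt b b' n : (forall i, (i < n)%N -> b i = b' i) ->
  b n = false -> b' n = true -> real_of_bits b < real_of_bits b'.
Proof.
move=> /eq_bit_sum bb' bn b'n.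
have /andP[_ ub] := real_of_bits_bounds b n.+1.
have /andP[lb _] := real_of_bits_bounds b' n.+1.
move: ub lb; rewrite /bit_sum !big_ord_recr /= -!/(bit_sum _ _) bb' bn b'n.
rewrite exprS invfM.
have : 0 < (4%:R : R) ^- n by rewrite invr_gt0 exprn_gt0.
by rewrite /=; lra.
Qed.

Lemma real_of_bits_inj b b' : real_of_bits b = real_of_bits b' -> b =1 b'.
Proof.
move=> E n; elim/ltn_ind: n => n IHn.
case bn: (b n); case b'n: (b' n) => //.
- have := @real_of_bits_lt b' b n (fun i im => esym (IHn i im)) b'n bn.
  by rewrite E ltxx.
- have := @real_of_bits_lt b b' n IHn bn b'n.
  by rewrite E ltxx.
Qed.

End bits.

Lemma pow4_small (R : realType) (e : R) : 0 < e -> exists n, 2 * 4%:R ^- n < e.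
Proof.
move=> e0; have d0 : 0 <= 2 / e by rewrite divr_ge0 // ltW.
exists (Num.bound (2 / e)); have := archi_boundP d0.
set n := Num.bound _ => en.
rewrite -/(_ / _) ltr_pdivrMr ?exprn_gt0 // mulrC -ltr_pdivrMr //.
apply: lt_trans en _.
by rewrite -natrX ltr_nat ltn_expl.
Qed.

(** * Clopen covers and domination *)

(** The function c numbers the classes of points that lie in the same D i.  It
factors through the real number F x whose digits are the membership bits of x:
F is continuous because finitely many bits are locally constant, so its range is
countable, and F x determines all the bits. *)
Lemma clopen_classes_countable (R : realType) (T : topologicalType)
    (I : countType) (D : I -> set T) :
  borel_conjecture R -> rothberger T -> (forall i, clopen (D i)) ->
  exists c : T -> nat, forall x y, c x = c y -> forall i, D i x -> D i y.
Proof.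
move=> BC HR clD.
(* The digits are indexed by nat, with 0 at the numbers that encode no i. *)
pose E j : set T := if unpickle j is Some i then D i else set0.
have clE j : clopen (E j) by rewrite /E; case: unpickle => // ; exact: clopen0.
pose b x j := `[< E j x >].
pose F x : R := real_of_bits (b x).
have cF : continuous F.
  move=> x; apply/cvgrPdist_lt => e e0.
  have [n ne] := pow4_small e0.
  have agree m : nbhs x [set y | forall j, (j < m)%N -> b x j = b y j].
    elim: m => [|m IHm]; first by apply: filterE.
    have Em : nbhs x [set y | b x m = b y m].
      rewrite /b; have [Emx|nEmx] := asboolP (E m x).
        apply: filterS (open_nbhs_nbhs (conj (clE m).1 Emx)) => y Emy /=.
        by rewrite asboolT.
      apply: filterS (open_nbhs_nbhs (conj (closed_openC (clE m).2) nEmx)) => y Emy /=.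
      by rewrite asboolF.
    apply: filterS2 IHm Em => y /= IHy ym j.
    by rewrite ltnS leq_eqVlt => /orP[/eqP ->|/IHy].
  apply: filterS (agree n) => y /real_of_bits_close bxy.
  exact: le_lt_trans (bxy R) ne.
have /countable_injP[h hinj] := BC _ (rothberger_image_smz HR cF).
exists (h \o F) => x y /= /hinj; rewrite !inE => /(_ (imageT _ _) (imageT _ _)).
move=> /real_of_bits_inj bxy i Dix.
have := bxy (pickle i); rewrite /b /E pickleK.
by rewrite asboolT // => /esym/asboolP.
Qed.

(** The clopen sets included in a member of C form an open cover, from which the
Lindelof property extracts a sequence. *)
Lemma refine_clopen (R : realType) (T : topologicalType) (C : set (set T)) :
  borel_conjecture R -> T3_space T -> rothberger T -> open_cover C ->
  exists D U : nat -> set T,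
    [/\ forall i, clopen (D i), forall x, exists i, D i x,
        forall i, D i `<=` U i & forall i, C (U i)].
Proof.
move=> BC T3 HR [oC covC].
have [|D [CD covD]] := @rothberger_lindelof T
    [set D | clopen D /\ exists2 U, C U & D `<=` U] HR.
  split; first by move=> D [[]].
  apply/seteqP; split=> // x _.
  have : [set: T] x by [].
  rewrite -covC => -[U CU Ux].
  have [D [clD Dx DU]] := rothberger_zero_dim BC T3 HR (oC _ CU) Ux.
  by exists D => //; split=> //; exists U.
have /choice[U HU] : forall i, exists U, C U /\ D i `<=` U.
  by move=> i; have [_ [U]] := CD i; exists U.
exists D, U; split=> // i; first by have [] := CD i.
- by have [] := HU i.
- by have [] := HU i.
Qed.

Lemma diagonal_bound (p : nat -> nat -> nat) :
  exists g : nat -> nat, forall m n, (m <= n)%N -> (p m n <= g n)%N.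
Proof.
exists (fun n => \max_(m < n.+1) p m n)%N => m n mn.
exact: (@leq_bigmax _ (fun m : 'I_n.+1 => p m n) (Ordinal (mn : (m < n.+1)%N))).
Qed.

(** A gamma-cover is an infinite set of open sets, while the sequence W may
repeat.  If it has finitely many values, one of them is taken infinitely often,
and then every point belongs to it. *)
Lemma eventual_cover (T : topologicalType) (W : nat -> set T) :
  (forall n, open (W n)) ->
  (forall x, exists m, forall n, (m <= n)%N -> W n x) ->
  gamma_cover (range W) \/ exists n, W n = [set: T].
Proof.
move=> oW evW.
have [|nW] := pselect (exists n, W n = [set: T]); first by right.
left; split.
- split; first by move=> _ [n _ <-].
  apply/seteqP; split=> // x _; have [m Wm] := evW x.
  by exists (W m); [exists m|exact: Wm].
- exact: (card_le_trans (card_image_le _ _)).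
- move=> finW; apply: nW.
  have [_ [n _ <-] infS] :
      exists2 S, range W S & infinite_set (W @^-1` [set S]).
    apply: contrapT => nS; apply: infinite_nat.
    have -> : [set: nat] = \bigcup_(S in range W) (W @^-1` [set S]).
      by apply/seteqP; split=> // n _; exists (W n) => //; exists n.
    apply: bigcup_finite => // S WS; apply: contrapT => infS.
    by apply: nS; exists S.
  exists n; apply/seteqP; split=> // x _; have [m Wm] := evW x.
  apply: contrapT => nWnx; apply: infS.
  apply: (@sub_finite_set _ _ `I_m); last exact: finite_II.
  move=> k /= Wk; rewrite ltnNge; apply/negP => /Wm.
  by rewrite Wk.
- move=> x; have [m Wm] := evW x.
  apply: (@sub_finite_set _ _ (W @` `I_m)).
    move=> _ [[n _ <-] nWx]; exists n => //=.
    by rewrite ltnNge; apply/negP => /Wm.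
  exact/finite_image/finite_II.
Qed.

Theorem theorem19 (R : realType) (BC : borel_conjecture R)
    (T : topologicalType) (T3 : T3_space T) (HR : rothberger T) :
  hurewicz T.
Proof.
move=> C gC.
have oC n : open_cover (C n) by have [] := gC n.
have /choice[D /choice[U DU]] := fun n => refine_clopen BC T3 HR (oC n).
have [c cD] : exists c : T -> nat,
    forall x y, c x = c y -> forall n i, D n i x -> D n i y.
  have [|c cD] := @clopen_classes_countable R T (nat * nat)%type
    (fun u => D u.1 u.2) BC HR.
    by move=> [n i]; have [] := DU n.
  by exists c => x y cxy n i; exact: (cD x y cxy (n, i)).
have /choice[p pD] : forall m, exists q : nat -> nat,
    forall x, c x = m -> forall n, D n (q n) x.
  move=> m; have [[y cy]|nm] := pselect (exists y, c y = m); last first.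
    by exists id => x cx; case: nm; exists x.
  have /choice[q qD] : forall n, exists i, D n i y.
    by move=> n; have [_ /(_ y)] := DU n.
  by exists q => x cx n; apply: (cD y x) => //; rewrite cy cx.
(* The m-th class is only controlled from n = m on, which is enough because the
   unions need only contain each point eventually. *)
have [g gp] := diagonal_bound p.
exists (fun n => U n @` `I_(g n).+1); split.
  move=> n; split; first exact/finite_image/finite_II.
  by move=> _ [i _ <-]; have [_ _ _] := DU n.
apply: eventual_cover.
  move=> n; apply: bigcup_open => _ [i _ <-].
  by have [_ _ _ CU] := DU n; exact: (oC n).1.
move=> x; exists (c x) => n cxn; exists (U n (p (c x) n)).
  by exists (p (c x) n) => //=; rewrite ltnS gp.
by have [_ _ sDU _] := DU n; apply: sDU; exact: pD.
Qed.
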